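(* Let $A,B:\mathbb{R}^n\rightrightarrows\mathbb{R}^n$ and $\beta_{\rm P},\beta_{\rm D}\in\mathbb{R}$ with $[\beta_{\rm D}]_-[\beta_{\rm P}]_-<\tfrac14$. Suppose that the primal-dual operator $T_{\mathrm{PD}}$ is maximally $V$-comonotone with $V:=\operatorname{blkdiag}(\beta_{\rm P}\mathrm{I}_n,\beta_{\rm D}\mathrm{I}_n)$, that $\operatorname{zer}T_{\mathrm{PD}}$ is nonempty, and that $$\gamma\in\left(\frac{2[-\beta_{\rm P}]_+}{1+\sqrt{1-4\beta_{\rm D}\beta_{\rm P}}},\ \frac{1+\sqrt{1-4\beta_{\rm D}\beta_{\rm P}}}{2[-\beta_{\rm D}]_+}\right).$$ Consider a sequence $(u^k,v^k,s^k)_{k\in\mathbb{N}}$ generated by Douglas–Rachford splitting (DRS) starting from $s^0\in\mathbb{R}^n$ with stepsize $\gamma$ and relaxation parameters $\lambda_k\in(0,2\alpha)$ such that $\lambda_k(2\alpha-\lambda_k)\ge\kappa>0$ uniformly for all $k$, where $\alpha:=1+\tfrac1\gamma\beta_{\rm P}+\gamma\beta_{\rm D}>0$. Then, for all $s^\star\in\{x^\star-\gamma y^\star\mid(x^\star,y^\star)\in\operatorname{zer}T_{\mathrm{PD}}\}$, $$\|u^N-v^N\|^2\le\frac{\|s^0-s^\star\|^2}{(N+1)\kappa}\qquad\text{and}\qquad\|u^N-v^N\|^2=o\big(1/(N+1)\big).$$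
   Context: For a set-valued operator $T$: $\operatorname{gph}T=\{(x,y):y\in Tx\}$, $\operatorname{zer}T=\{x:0\in Tx\}$. Resolvent: $J_A=(\mathrm{id}+A)^{-1}$. $[t]_+=\max\{0,t\}$, $[t]_-=\min\{0,t\}$; the right endpoint of the stepsize interval is read as $+\infty$ when $[-\beta_{\rm D}]_+=0$ and the left endpoint as $0$ when $[-\beta_{\rm P}]_+=0$. (DRS): $u^k\in J_{\gamma A}(s^k)$, $v^k\in J_{\gamma B}(2u^k-s^k)$, $s^{k+1}=s^k+\lambda_k(v^k-u^k)$. Primal-dual operator on $\mathbb{R}^{2n}$: $T_{\mathrm{PD}}(x,y)=\big(Ax+y\big)\times\big(B^{-1}y-x\big)$. $T$ is $V$-comonotone ($V$ symmetric) if $\langle x-x',y-y'\rangle\ge\langle y-y',V(y-y')\rangle$ for all $(x,y),(x',y')\in\operatorname{gph}T$; maximally $V$-comonotone if moreover its graph is not strictly contained in the graph of another $V$-comonotone operator. $a_N=o(1/(N+1))$ means $(N+1)a_N\to0$. *)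

(* Defs.v *)
From HB Require Import structures.
From mathcomp Require Import all_boot all_order all_algebra.
From mathcomp Require Import all_classical all_reals.
From mathcomp Require Import ereal topology normedtype sequences.

Set Implicit Arguments.
Unset Strict Implicit.
Unset Printing Implicit Defensive.

Import Order.TTheory GRing.Theory Num.Theory.
Import numFieldNormedType.Exports.

Local Open Scope classical_set_scope.
Local Open Scope ring_scope.

Section Euclidean.
Context {R : realType} {n : nat}.
Implicit Types x y : 'cV[R]_n.

Definition dot x y : R := \sum_(i < n) x i 0 * y i 0.

(* The Euclidean norm; the norm `|x| that MathComp-Analysis puts on matrices
   is the maximum norm. *)
Definition enorm x : R := Num.sqrt (dot x x).

End Euclidean.

Section SetValuedOperators.
Context {R : realType} {n : nat}.

Definition operator := 'cV[R]_n -> set 'cV[R]_n.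

Implicit Types (T : operator) (V : 'M[R]_n).

Definition gph T : set ('cV[R]_n * 'cV[R]_n) := [set p | T p.1 p.2].

Definition zer T : set 'cV[R]_n := [set x | T x 0].

Definition op_inv T : operator := fun y => [set x | T x y].

Definition op_scale (c : R) T : operator := fun x => [set c *: a | a in T x].

Definition id_plus T : operator := fun x => [set x + a | a in T x].

Definition resolvent T : operator := op_inv (id_plus T).

Definition comonotone V T : Prop :=
  V^T = V /\
  forall x x' y y', gph T (x, y) -> gph T (x', y') ->
    dot (x - x') (y - y') >= dot (y - y') (V *m (y - y')).

Definition max_comonotone V T : Prop :=
  comonotone V T /\
  forall T', comonotone V T' -> ~ (gph T `<` gph T').

End SetValuedOperators.

Arguments operator : clear implicits.

Definition primal_dual {R : realType} {n : nat} (A B : operator R n) :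
    operator R (n + n) :=
  fun z => let x := usubmx z in let y := dsubmx z in
    [set col_mx (a + y) (b - x) | a in A x & b in op_inv B y].

Definition blkdiag2 {R : realType} (n : nat) (p d : R) : 'M[R]_(n + n) :=
  block_mx p%:M 0 0 d%:M.

Definition is_DRS {R : realType} {n : nat} (A B : operator R n) (gamma : R)
    (lambda : nat -> R) (u v s : nat -> 'cV[R]_n) : Prop :=
  forall k,
    [/\ resolvent (op_scale gamma A) (s k) (u k),
        resolvent (op_scale gamma B) (2 *: u k - s k) (v k) &
        s k.+1 = s k + lambda k *: (v k - u k)].

Section StepsizeInterval.
Context {R : realType}.
Implicit Types t betaP betaD : R.

Definition pos_part t : R := Num.max 0 t.
Definition neg_part t : R := Num.min 0 t.

(* When neg_part betaD * neg_part betaP < 1/4, the radicand 1 - 4 betaD betaP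
   can be negative only if betaP and betaD are both positive; the stepsize
   interval is then ]0, +oo[, whatever the value of the square root. *)
Definition stepsize_root betaP betaD : R :=
  1 + Num.sqrt (1 - 4 * betaD * betaP).

Definition stepsize_lo betaP betaD : \bar R :=
  if pos_part (- betaP) == 0 then 0%E
  else (2 * pos_part (- betaP) / stepsize_root betaP betaD)%:E.

Definition stepsize_hi betaP betaD : \bar R :=
  if pos_part (- betaD) == 0 then +oo%E
  else (stepsize_root betaP betaD / (2 * pos_part (- betaD)))%:E.

End StepsizeInterval.

(* Main.v *)
Require Import Defs.
From HB Require Import structures.
From mathcomp Require Import all_boot all_order all_algebra.
From mathcomp Require Import all_classical all_reals.
From mathcomp Require Import ereal topology normedtype sequences.
From mathcomp Require Import ring lra zify.

(** A Douglas-Rachford step from [s] yields [(u, v)] with residual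
    [d = u - v]; write [s = u + gamma a] and [2 u - s = v + gamma b] with [a]
    in [A u] and [b] in [B v].  The pair [(u, b)] is then a primal-dual point whose
    image under [T_PD] contains [(d / gamma, - d)]: both the primal and the dual
    residuals of the step are multiples of [d].  Since moreover
    [s - d = u - gamma b], comonotonicity of [T_PD] turns into a cocoercivity
    property of the map from [s] to [d]:
      [<s - s', d - d'> >= alpha |d - d'| ^ 2]    ([residual_cocoercive]).
    Everything else is the classical analysis of a relaxed fixed-point
    iteration [s_{k+1} = s_k - lambda_k d_k] driven by a cocoercive residual.

    A zero [(x, y)] of [T_PD] gives the stationary step with [u = v = x]
    started at [s = x - gamma y].  Comparing an iterate with this step gives
    the Fejer inequality
      [|s_{k+1} - s*| ^ 2 <= |s_k - s*| ^ 2 - lambda_k (2 alpha - lambda_k) |d_k| ^ 2],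
    so that the [kappa |d_k| ^ 2] sum to at most [|s_0 - s*| ^ 2].  Comparing two
    consecutive iterates shows that [|d_k|] is nonincreasing.  A nonincreasing
    summable sequence is bounded by its average and is [o(1 / (N + 1))].

    Finally, [gamma * alpha] is the quadratic [betaD gamma ^ 2 + gamma + betaP], and
    the endpoints of the stepsize interval, when neither zero nor infinite, are
    roots of it, written in the form that survives vanishing coefficients
    ([stepsize_alpha_gt0]). *)

Set Implicit Arguments.
Unset Strict Implicit.
Unset Printing Implicit Defensive.

Import Order.TTheory GRing.Theory Num.Theory.
Import numFieldNormedType.Exports.

Local Open Scope classical_set_scope.
Local Open Scope ring_scope.

(** * Euclidean inner product *)

Section DotProduct.
Context {R : realType}.

Lemma dotC n (x y : 'cV[R]_n) : dot x y = dot y x.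
Proof. by apply: eq_bigr => i _; rewrite mulrC. Qed.

Lemma dotDl n (x y z : 'cV[R]_n) : dot (x + y) z = dot x z + dot y z.
Proof. by rewrite -big_split; apply: eq_bigr => i _; rewrite mxE mulrDl. Qed.

Lemma dotZl n c (x z : 'cV[R]_n) : dot (c *: x) z = c * dot x z.
Proof. by rewrite mulr_sumr; apply: eq_bigr => i _; rewrite mxE mulrA. Qed.

Lemma dotNl n (x z : 'cV[R]_n) : dot (- x) z = - dot x z.
Proof. by rewrite -scaleN1r dotZl mulN1r. Qed.

Lemma dotDr n (x y z : 'cV[R]_n) : dot z (x + y) = dot z x + dot z y.
Proof. by rewrite dotC dotDl !(dotC z). Qed.

Lemma dotZr n c (x z : 'cV[R]_n) : dot z (c *: x) = c * dot z x.
Proof. by rewrite dotC dotZl (dotC z). Qed.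

Lemma dotNr n (x z : 'cV[R]_n) : dot z (- x) = - dot z x.
Proof. by rewrite dotC dotNl (dotC z). Qed.

Definition dotE := (dotDl, dotDr, dotNl, dotNr, dotZl, dotZr).

Lemma dot_ge0 n (x : 'cV[R]_n) : 0 <= dot x x.
Proof. by apply: sumr_ge0 => i _; rewrite -expr2 sqr_ge0. Qed.

Lemma enorm_sqr n (x : 'cV[R]_n) : enorm x ^+ 2 = dot x x.
Proof. by rewrite sqr_sqrtr // dot_ge0. Qed.

Lemma dot_col_mx n m (x x' : 'cV[R]_n) (y y' : 'cV[R]_m) :
  dot (col_mx x y) (col_mx x' y') = dot x x' + dot y y'.
Proof.
rewrite /dot big_split_ord.
by congr (_ + _); apply: eq_bigr => i _; rewrite ?col_mxEu ?col_mxEd.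
Qed.

Lemma blkdiag2_mul_col_mx n (p d : R) (x y : 'cV[R]_n) :
  blkdiag2 n p d *m col_mx x y = col_mx (p *: x) (d *: y).
Proof. by rewrite mul_block_col !mul0mx addr0 add0r !mul_scalar_mx. Qed.

End DotProduct.

(** * Positivity of alpha on the stepsize interval *)

Section Stepsize.
Context {R : realType}.

(** When the radicand is nonnegative, put [q = sqrt (1 - 4 betaD betaP)] and
    [c = 1 + q]; the identity [4 betaD betaP = (1 - q) (1 + q) = (2 - c) c]
    yields the factorization
      [(c gamma + 2 betaP) (c + 2 betaD gamma)
         = 2 c (betaD gamma ^ 2 + gamma + betaP)],
    and each endpoint of the stepsize interval makes one of the two factors on
    the left positive. *)
Lemma stepsize_alpha_gt0 (betaP betaD gamma : R) :
  neg_part betaD * neg_part betaP < 4^-1 ->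
  (stepsize_lo betaP betaD < gamma%:E < stepsize_hi betaP betaD)%E ->
  0 < gamma /\ 0 < 1 + gamma^-1 * betaP + gamma * betaD.
Proof.
rewrite /stepsize_lo /stepsize_hi /stepsize_root => hneg /andP[].
set q := Num.sqrt _; have q_ge0 : 0 <= q by exact: sqrtr_ge0.
have c_gt0 : 0 < 1 + q by lra.
have pos_partE (t : R) : pos_part (- t) = if 0 <= t then 0 else - t.
  by rewrite /pos_part /Num.max oppr_gt0 leNgt; case: ltP.
move=> lo hi.
have [gamma_gt0 lo_factor] : 0 < gamma /\ 0 < (1 + q) * gamma + 2 * betaP.
  move: lo; rewrite pos_partE; case: (leP 0 betaP) => hP.
    rewrite eqxx lte_fin => g0; split=> //.
    by rewrite ltr_pwDl ?mulr_gt0 // mulr_ge0.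
  rewrite oppr_eq0 lt_eqF // lte_fin ltr_pdivrMr // => h; split; last by lra.
  by rewrite -(pmulr_lgt0 _ c_gt0); lra.
have hi_factor : 0 < (1 + q) + 2 * betaD * gamma.
  move: hi; rewrite pos_partE; case: (leP 0 betaD) => hD.
    by move=> _; rewrite ltr_pwDl // !mulr_ge0 // ltW.
  rewrite oppr_eq0 lt_eqF // lte_fin ltr_pdivlMr; [lra | lra].
split=> //.
have -> : 1 + gamma^-1 * betaP + gamma * betaD
    = (betaD * gamma ^+ 2 + gamma + betaP) / gamma.
  by field; rewrite gt_eqF.
rewrite divr_gt0 //.
case: (leP 0 (1 - 4 * betaD * betaP)) => rad.
  have qE : q ^+ 2 = 1 - 4 * betaD * betaP by rewrite sqr_sqrtr.
  have := mulr_gt0 lo_factor hi_factor.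
  have -> : ((1 + q) * gamma + 2 * betaP) * (1 + q + 2 * betaD * gamma)
      = (1 + q) * (2 * (betaD * gamma ^+ 2 + gamma + betaP)).
    have -> : ((1 + q) * gamma + 2 * betaP) * (1 + q + 2 * betaD * gamma)
      = (1 + q) * (2 * (betaD * gamma ^+ 2 + betaP)) +
        gamma * ((1 + q) ^+ 2 + (1 - (1 - 4 * betaD * betaP))) by ring.
    by rewrite -qE; ring.
  by rewrite pmulr_rgt0 // pmulr_rgt0.
(* A negative radicand forces betaD and betaP to have the same sign, and the
   bound on the product of the negative parts rules out the negative one. *)
have betaDP_gt0 : 0 < betaD * betaP by lra.
have : (0 < betaD) /\ (0 < betaP).
  case: (ltrgt0P betaD) betaDP_gt0 => hD; last by rewrite hD mul0r ltxx.
    by rewrite pmulr_rgt0.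
  rewrite nmulr_rgt0 // => hP; move: hneg.
  by rewrite /neg_part /Num.min !ltNge !ltW //=; lra.
by case=> hD hP; rewrite !addr_gt0 // mulr_gt0 // exprn_gt0.
Qed.

End Stepsize.

(** * Cocoercivity of the Douglas-Rachford residual *)

Section Step.
Context {R : realType} {n : nat}.
Variables (A B : operator R n) (gamma : R).
Hypothesis gamma_gt0 : 0 < gamma.

Definition DRS_step (s u v : 'cV[R]_n) : Prop :=
  resolvent (op_scale gamma A) s u /\
  resolvent (op_scale gamma B) (2 *: u - s) v.

(** The dual point is determined by the step as
    [b = (2 u - s - v) / gamma], the element of [B v] selected by the second
    resolvent. *)
Lemma DRS_step_primal_dual s u v : DRS_step s u v ->
  gph (primal_dual A B)
    (col_mx u (gamma^-1 *: (2 *: u - s - v)),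
     col_mx (gamma^-1 *: (u - v)) (v - u)).
Proof.
have gK (x : 'cV[R]_n) : gamma^-1 *: (gamma *: x) = x.
  by rewrite scalerA mulVf ?gt_eqF // scale1r.
case=> [[_ [a Aa <-] sE] [_ [b Bb <-] tE]].
have bE : gamma^-1 *: (2 *: u - s - v) = b by rewrite -tE addrC addKr gK.
rewrite /gph /primal_dual /= col_mxKu col_mxKd bE.
exists a => //; exists v => //; congr col_mx.
rewrite -(gK a) -bE -scalerDr; congr (_ *: _).
have -> : gamma *: a = s - u by rewrite -sE addrC addKr.
by apply/matrixP => i j; rewrite !mxE; ring.
Qed.

(** Seen as a step with zero residual, a zero of the primal-dual operator can
    be compared with an iterate by the same inequality as two iterates. *)
Lemma zer_primal_dual_DRS_step z : zer (primal_dual A B) z ->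
  DRS_step (usubmx z - gamma *: dsubmx z) (usubmx z) (usubmx z).
Proof.
rewrite /zer /primal_dual /= -col_mx0; case=> a Aa [b Bb /eq_col_mx[/eqP ay /eqP bx]].
move: ay bx; rewrite addr_eq0 subr_eq0 => /eqP aE /eqP bE.
split.
  exists (gamma *: a); first by exists a.
  by rewrite aE scalerN.
exists (gamma *: dsubmx z); first by exists (dsubmx z); rewrite // -bE.
by rewrite opprB addrCA scaler_nat mulr2n addrK addrC.
Qed.

(** The image point attached to a step depends on the residual [u - v] alone,
    and linearly.  For the difference [t] of two starting points and the
    difference [e] of their residuals, the weighted norm on the right of
    comonotonicity is therefore [(betaP / gamma ^ 2 + betaD) |e| ^ 2], while the
    inner product on the left collapses to [<t - e, e> / gamma]. *)
Lemma residual_cocoercive (betaP betaD : R) s u v s' u' v' :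
  comonotone (blkdiag2 n betaP betaD) (primal_dual A B) ->
  DRS_step s u v -> DRS_step s' u' v' ->
  (1 + gamma^-1 * betaP + gamma * betaD)
      * dot (u - v - (u' - v')) (u - v - (u' - v'))
    <= dot (s - s') (u - v - (u' - v')).
Proof.
move=> [_ mono] step step'; set e := u - v - (u' - v').
have st := DRS_step_primal_dual step; have st' := DRS_step_primal_dual step'.
have := mono _ _ _ _ st st'.
rewrite !opp_col_mx !add_col_mx blkdiag2_mul_col_mx !dot_col_mx.
have -> : gamma^-1 *: (u - v) - gamma^-1 *: (u' - v') = gamma^-1 *: e.
  by rewrite -scalerBr.
have -> : v - u - (v' - u') = - e.
  by rewrite /e; apply/matrixP => i j; rewrite !mxE; ring.
rewrite -scalerBr.
have -> : 2 *: u - s - v - (2 *: u' - s' - v') = (u - u') + e - (s - s').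
  by apply/matrixP => i j; rewrite !mxE; ring.
move: (u - u') (s - s') e => w t e; rewrite !dotE.
rewrite -subr_ge0 -(pmulr_rge0 _ gamma_gt0) -[in X in _ -> X]subr_ge0.
congr (is_true (0 <= _)).
by field; rewrite gt_eqF.
Qed.

End Step.

(** * Nonincreasing summable sequences *)

Section NonincreasingSummable.
Context {R : realType}.
Variable a : nat -> R.
Hypothesis a_ge0 : forall k, 0 <= a k.
Hypothesis a_decr : forall k, a k.+1 <= a k.

Lemma nonincreasing_le_sum m N : (m <= N.+1)%N ->
  (N.+1 - m)%:R * a N <= \sum_(m <= k < N.+1) a k.
Proof.
move=> mN; rewrite mulr_natl -sumr_const_nat.
rewrite big_nat_cond [leRHS]big_nat_cond; apply: ler_sum => k.
rewrite andbT => /andP[_ kN].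
have decr : {homo a : i j / (i <= j)%N >-> j <= i}.
  by apply/nonincreasing_seqP.
exact: decr.
Qed.

(** The upper half of the indices up to [N] contains at least [(N + 1) / 2]
    terms, each at least [a N]; hence [(N + 1) a N] is at most twice a slice
    of a convergent series whose endpoints both go to infinity. *)
Lemma nonincreasing_summable_littleo (M : R) :
  (forall N, \sum_(0 <= k < N) a k <= M) ->
  (fun N : nat => N.+1%:R * a N) @ \oo --> (0 : R).
Proof.
move=> bounded; pose S := series a.
have S_cvg : cvgn S.
  apply: nondecreasing_is_cvgn.
    by apply/nondecreasing_seqP => N; rewrite /S /series /= big_nat_recr //= lerDl.
  by exists M => _ [N _ <-]; exact: bounded.
have half_cvg : (fun N => S N./2) @ \oo --> lim (S @ \oo).
  have half_oo : half @ \oo --> \oo.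
    apply/cvgnyPge => p; near=> N.
    rewrite -(doubleK p); apply: half_leq.
    by near: N; exact: nbhs_infty_ge.
  apply: (@cvg_comp _ _ _ half S _ _ _ half_oo); exact: S_cvg.
have succ_cvg : (fun N => S N.+1) @ \oo --> lim (S @ \oo).
  by rewrite (cvg_shiftS S).
have slice_cvg : (fun N => 2 * (S N.+1 - S N./2)) @ \oo --> (0 : R).
  rewrite -(mulr0 2) -(subrr (lim (S @ \oo))).
  by apply: cvgMr; exact: cvgB.
apply: (squeeze_cvgr _ (cvg_cst 0) slice_cvg).
near=> N; rewrite mulr_ge0 //=.
have halfN : (N./2 <= N.+1)%N by lia.
rewrite sub_series_geq //.
apply: le_trans (ler_wpM2l _ (nonincreasing_le_sum halfN)) => //.
rewrite mulrA ler_wpM2r // -natrM ler_nat.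
by lia.
Unshelve. all: by end_near.
Qed.

End NonincreasingSummable.

(** * Relaxed fixed-point iterations *)

Section RelaxedIteration.
Context {R : realType} {n : nat}.
Implicit Types s d : 'cV[R]_n.

(** Expanding [|s - lambda d - s*| ^ 2], the cross term is bounded by
    cocoercivity of the residual at the iterate, whose value at [s*] is zero. *)
Lemma fejer_step (alpha lambda : R) s d sstar : 0 < lambda ->
  alpha * dot d d <= dot (s - sstar) d ->
  lambda * (2 * alpha - lambda) * dot d d
    <= dot (s - sstar) (s - sstar)
       - dot (s - lambda *: d - sstar) (s - lambda *: d - sstar).
Proof.
move=> l0 h; rewrite addrAC; move: (s - sstar) h => t h.
have : 0 <= lambda * (dot t d - alpha * dot d d).
  by rewrite mulr_ge0 ?(ltW l0) ?subr_ge0.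
rewrite !dotE (dotC d t); lra.
Qed.

(** Here [- lambda d] is the displacement between two consecutive iterates
    with residuals [d] and [d']. *)
Lemma residual_decr (alpha lambda : R) d d' : 0 < lambda < 2 * alpha ->
  alpha * dot (d' - d) (d' - d) <= dot (- (lambda *: d)) (d' - d) ->
  dot d' d' <= dot d d.
Proof.
move=> /andP[l0 la] h.
have -> : d' = d + (d' - d) by rewrite addrC subrK.
move: (d' - d) h => e; rewrite !dotE (dotC e d) => h.
have pos : 0 <= (2 * alpha - lambda) * dot e e.
  by rewrite mulr_ge0 ?dot_ge0 // subr_ge0 ltW.
rewrite -subr_ge0 -(pmulr_rge0 _ l0); lra.
Qed.

End RelaxedIteration.

(** * Convergence rate of Douglas-Rachford splitting *)

Theorem corollary3p4 (R : realType) (n : nat) (A B : operator R n)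
    (betaP betaD gamma : R) (alpha := 1 + gamma^-1 * betaP + gamma * betaD) :
  neg_part betaD * neg_part betaP < 4^-1 ->
  max_comonotone (blkdiag2 n betaP betaD) (primal_dual A B) ->
  zer (primal_dual A B) !=set0 ->
  (stepsize_lo betaP betaD < gamma%:E < stepsize_hi betaP betaD)%E ->
  0 < alpha /\
  forall (kappa : R) (lambda : nat -> R) (u v s : nat -> 'cV[R]_n),
    is_DRS A B gamma lambda u v s ->
    (forall k, 0 < lambda k < 2 * alpha) ->
    0 < kappa ->
    (forall k, kappa <= lambda k * (2 * alpha - lambda k)) ->
    forall sstar : 'cV[R]_n,
      [set usubmx z - gamma *: dsubmx z | z in zer (primal_dual A B)] sstar ->
      (forall N : nat, enorm (u N - v N) ^+ 2 <=
         enorm (s 0%N - sstar) ^+ 2 / (N.+1%:R * kappa)) /\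
      (fun N : nat => N.+1%:R * enorm (u N - v N) ^+ 2) @ \oo --> (0 : R).
Proof.
move=> hneg [mono _] _ /(stepsize_alpha_gt0 hneg)[gamma_gt0 alpha_gt0]; split=> //.
move=> kappa lambda u v s drs lambda_bd kappa_gt0 kappa_le sstar [z zz sstarE].
pose d k := u k - v k.
have step k : DRS_step A B gamma (s k) (u k) (v k) by case: (drs k).
have sS k : s k.+1 = s k - lambda k *: d k.
  by case: (drs k) => _ _ ->; rewrite -scalerN opprB.
have d_decr k : dot (d k.+1) (d k.+1) <= dot (d k) (d k).
  apply: residual_decr (lambda_bd k) _.
  have := residual_cocoercive gamma_gt0 mono (step k.+1) (step k).
  suff -> : s k.+1 - s k = - (lambda k *: d k) by [].
  by rewrite sS addrAC subrr add0r.
have fejer k : kappa * dot (d k) (d k)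
    <= dot (s k - sstar) (s k - sstar) - dot (s k.+1 - sstar) (s k.+1 - sstar).
  apply: le_trans (ler_wpM2r (dot_ge0 _) (kappa_le k)) _.
  rewrite sS; apply: fejer_step; first by case/andP: (lambda_bd k).
  have := residual_cocoercive gamma_gt0 mono (step k)
    (zer_primal_dual_DRS_step gamma zz).
  by rewrite sstarE subrr subr0.
have sum_le N :
    \sum_(0 <= k < N) dot (d k) (d k) <= enorm (s 0%N - sstar) ^+ 2 / kappa.
  rewrite ler_pdivlMr // mulrC mulr_sumr enorm_sqr.
  apply: le_trans (ler_sum _ (fun k _ => fejer k)) _.
  rewrite -[leLHS]opprK -sumrN.
  under eq_bigr do rewrite opprB.
  by rewrite (telescope_sumr (fun k => dot (s k - sstar) (s k - sstar))) // opprB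
    gerBl dot_ge0.
split=> [N|].
  have := le_trans (nonincreasing_le_sum d_decr (leq0n N.+1)) (sum_le N.+1).
  by rewrite subn0 (enorm_sqr (u N - v N)) invfM mulrCA ler_pdivlMl.
under eq_fun do rewrite enorm_sqr.
exact: nonincreasing_summable_littleo (fun k => dot_ge0 (d k)) d_decr _ sum_le.
Qed.
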